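(* Let $G$ be a bipartite graph, let $t_\Delta$ be the number of vertices of $G$ of degree $\Delta(G)$, and let $G_\Delta$ be the subgraph of $G$ induced by the vertices of degree $\Delta(G)$. Then $$\mathrm{es}_{\chi'}(G)=t_\Delta-\alpha'(G_\Delta),$$ where $\alpha'(G_\Delta)$ is the matching number of $G_\Delta$, i.e. the size of a maximum matching in $G_\Delta$.
   Context: All graphs (other than subgraphs such as $G_\Delta$ or graphs obtained by deleting edges) are finite, simple (no loops or multiple edges) and have at least one edge. $\Delta(G)$ denotes the maximum degree of $G$. A matching is a set of pairwise non-incident edges; the matching number of an edgeless graph is $0$. The chromatic index $\chi'(G)$ is the minimum number of colors in a proper edge coloring of $G$ (incident edges receive different colors); an edgeless graph has chromatic index $0$. The chromatic edge stability index $\mathrm{es}_{\chi'}(G)$ is the minimum number of edges of $G$ whose removal (keeping all vertices) results in a graph $H$ with $\chi'(H)=\chi'(G)-1$; equivalently, the minimum size of a set $F\subseteq E(G)$ with $\chi'(G\setminus F)<\chi'(G)$. *)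

(* Defs.v *)
From mathcomp Require Import all_boot.
Set Implicit Arguments.
Unset Strict Implicit.
Unset Printing Implicit Defensive.

(* The graph may have no edges; "at least one edge" is a separate hypothesis,
   since induced subgraphs and edge deletions can be edgeless. *)
Record sgraph := SGraph {
  vertex :> finType;
  adj : rel vertex;
  adj_sym : symmetric adj;
  adj_irrefl : irreflexive adj
}.

Definition edges (G : sgraph) : {set {set G}} :=
  [set [set x; y] | x in G, y in G & adj x y].

Lemma edgesP (G : sgraph) (f : {set G}) :
  reflect (exists x y : G, adj x y /\ f = [set x; y]) (f \in edges G).
Proof.
apply: (iffP imset2P) => [[x y _ xy ->]|[x [y [xy ->]]]].
  by move: xy; rewrite inE => /andP[_ xy]; exists x, y.
by exists x y; rewrite // inE.
Qed.

Definition edge (G : sgraph) : finType := {f : {set G} | f \in edges G}.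

Definition bipartite (G : sgraph) : Prop :=
  exists A : {set G}, forall x y : G, adj x y -> (x \in A) != (y \in A).

Definition degree (G : sgraph) (x : G) : nat := #|[set y | adj x y]|.

Definition max_degree (G : sgraph) : nat := \max_(x : G) degree x.

Definition max_degree_vertices (G : sgraph) : {set G} :=
  [set x | degree x == max_degree G].

Section Induced.
Variables (G : sgraph) (A : {set G}).

Definition induced_adj : rel {x : G | x \in A} :=
  fun u v => adj (val u) (val v).

Lemma induced_sym : symmetric induced_adj.
Proof. by move=> u v; apply: adj_sym. Qed.

Lemma induced_irrefl : irreflexive induced_adj.
Proof. by move=> u; apply: adj_irrefl. Qed.

Definition induced : sgraph := SGraph induced_sym induced_irrefl.
End Induced.

Section DeleteEdges.
Variables (G : sgraph) (F : {set {set G}}).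

Definition delete_adj : rel G := fun x y => adj x y && ([set x; y] \notin F).

Lemma delete_sym : symmetric delete_adj.
Proof. by move=> x y; rewrite /delete_adj adj_sym setUC. Qed.

Lemma delete_irrefl : irreflexive delete_adj.
Proof. by move=> x; rewrite /delete_adj adj_irrefl. Qed.

Definition delete_edges : sgraph := SGraph delete_sym delete_irrefl.
End DeleteEdges.

(* As edges are nonempty sets, trivIset says that distinct members of M have
   no common end. *)
Definition matching (G : sgraph) (M : {set {set G}}) : bool :=
  (M \subset edges G) && trivIset M.

Definition matching_number (G : sgraph) : nat :=
  \max_(M : {set {set G}} | matching M) #|M|.

Definition incident (G : sgraph) (f g : edge G) : bool :=
  (f != g) && (val f :&: val g != set0).

Definition proper_coloring (G : sgraph) (k : nat)
    (c : {ffun edge G -> 'I_k}) : bool :=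
  [forall f : edge G, forall g : edge G, incident f g ==> (c f != c g)].

(* The domain consists of the edges only, so an edgeless graph is
   0-edge-colorable. *)
Definition edge_colorable (G : sgraph) (k : nat) : bool :=
  [exists c : {ffun edge G -> 'I_k}, proper_coloring c].

Lemma edge_colorable_ex (G : sgraph) : exists k, edge_colorable G k.
Proof.
exists #|edge G|; apply/existsP; exists [ffun f => enum_rank f].
apply/forallP=> f; apply/forallP=> g; apply/implyP=> /andP[fNg _].
by rewrite !ffunE (inj_eq enum_rank_inj).
Qed.

Definition chromatic_index (G : sgraph) : nat := ex_minn (edge_colorable_ex G).

(* A graph with at least one edge has positive chromatic index, so the
   predecessor is then a true subtraction. *)
Definition stability_witness (G : sgraph) (m : nat) : bool :=
  [exists F : {set {set G}},
    [&& F \subset edges G, #|F| == m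
      & chromatic_index (delete_edges F) == (chromatic_index G).-1]].

Lemma edges_delete (G : sgraph) (F : {set {set G}}) :
  edges (delete_edges F) = edges G :\: F.
Proof.
apply/setP=> f; rewrite inE; apply/edgesP/andP.
  case=> x [y [/andP[xy nF] ->]]; split=> //.
  by apply/edgesP; exists x, y.
case=> nF /edgesP[x [y [xy fE]]].
by exists x, y; rewrite /= /delete_adj xy -fE.
Qed.

Lemma chromatic_index_step (G : sgraph) (F : {set {set G}}) (f : {set G}) :
  chromatic_index (delete_edges (F :\ f))
    <= (chromatic_index (delete_edges F)).+1.
Proof.
rewrite {2}/chromatic_index; case: ex_minnP=> k /existsP[c /forallP cP] _.
rewrite /chromatic_index; case: ex_minnP=> l _; apply.
pose d (g : edge (delete_edges (F :\ f))) : 'I_k.+1 :=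
  if insub (val g) is Some g' then widen_ord (leqnSn k) (c g') else ord_max.
have only_f (g : edge (delete_edges (F :\ f))) :
    val g \notin edges (delete_edges F) -> val g = f.
  case: g => g /= gE; move: gE; rewrite !edges_delete !inE.
  by move=> /andP[+ ->]; rewrite andbT negbK; case: eqP => //= _ /negPf ->.
apply/existsP; exists (finfun d); apply/forallP=> g; apply/forallP=> h.
apply/implyP=> /andP[gNh gh]; rewrite !ffunE /d.
case: insubP=> [g' _ gE|/only_f gE]; case: insubP=> [h' _ hE|/only_f hE].
- have /implyP := forallP (cP g') h'.
  rewrite /incident -(inj_eq val_inj) gE hE (inj_eq val_inj) gNh gh.
  by move=> /(_ isT); apply: contra => /eqP/(congr1 val) /= e; apply/eqP/val_inj.
- by rewrite -val_eqE /= neq_ltn ltn_ord.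
- by rewrite -val_eqE /= neq_ltn ltn_ord orbT.
- by case/eqP: gNh; apply: val_inj; rewrite gE hE.
Qed.

Lemma chromatic_index_edgeless (G : sgraph) :
  edges G = set0 -> chromatic_index G = 0.
Proof.
move=> E0; rewrite /chromatic_index; case: ex_minnP=> k _ kmin.
have noedge : edge G -> False by case=> f /=; rewrite E0 inE.
apply/eqP; rewrite -leqn0; apply: kmin; apply/existsP.
exists [ffun f : edge G => False_rect 'I_0 (noedge f)].
by apply/forallP=> f; case: (noedge f).
Qed.

Lemma chromatic_index_delete0 (G : sgraph) :
  chromatic_index (delete_edges (set0 : {set {set G}})) = chromatic_index G.
Proof.
have aux (e1 e2 : rel G) (s1 : symmetric e1) (s2 : symmetric e2)
    (i1 : irreflexive e1) (i2 : irreflexive e2) : e1 =2 e2 ->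
    chromatic_index (SGraph s1 i1) <= chromatic_index (SGraph s2 i2).
  move=> e12; rewrite {2}/chromatic_index.
  case: ex_minnP=> k /existsP[c /forallP cP] _.
  rewrite /chromatic_index; case: ex_minnP=> l _; apply.
  have sub (g : edge (SGraph s1 i1)) : val g \in edges (SGraph s2 i2).
    case: g=> g /= gE; have [x [y [/= xy ->]]] := elimT (edgesP g) gE.
    by apply/(@edgesP (SGraph s2 i2)); exists x, y; rewrite /= -e12.
  pose j g : edge (SGraph s2 i2) := Sub (val g) (sub g).
  apply/existsP; exists [ffun g => c (j g)].
  apply/forallP=> g; apply/forallP=> h; apply/implyP=> gh; rewrite !ffunE.
  exact: (implyP (forallP (cP (j g)) (j h))).
have eqadj : delete_adj (set0 : {set {set G}}) =2 @adj G.
  by move=> x y; rewrite /delete_adj inE andbT.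
case: G eqadj aux => V e s i /= eqadj aux.
by apply/eqP; rewrite eqn_leq !aux // => x y; rewrite eqadj.
Qed.

Lemma stability_witness_ex (G : sgraph) : exists m, stability_witness G m.
Proof.
have [/eqP k0|k_gt0] := posnP (chromatic_index G).
  exists 0; apply/existsP; exists set0.
  by rewrite sub0set cards0 chromatic_index_delete0 (eqP k0) /=.
pose P (F : {set {set G}}) :=
  (F \subset edges G) && (chromatic_index (delete_edges F) < chromatic_index G).
have PE : P (edges G).
  rewrite /P subxx chromatic_index_edgeless //.
  by rewrite edges_delete setDv.
case: (arg_minnP (fun F : {set {set G}} => #|F|) PE) => F /andP[FE Flt] Fmin.
exists #|F|; apply/existsP; exists F; rewrite FE eqxx /=.
have [F0|[f fF]] := set_0Vmem F.
  by move: Flt; rewrite F0 chromatic_index_delete0 ltnn.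
rewrite eqn_leq -ltnS prednK // Flt /= -ltnS prednK //.
apply: leq_trans (chromatic_index_step F f).
rewrite leqNgt; apply/negP=> lt.
have := Fmin (F :\ f); rewrite /P lt andbT (subset_trans (subsetDl _ _) FE).
by move=> /(_ isT); rewrite [#|F|](cardsD1 f) fF ltnn.
Qed.

Definition edge_stability_index (G : sgraph) : nat :=
  ex_minn (stability_witness_ex G).

(* Main.v *)
Require Import Defs.
From mathcomp Require Import all_boot perm.

(** In a bipartite graph the chromatic index equals the maximum degree
    (König's theorem, [konig_edge_coloring]).  A graph obtained by deleting a
    set [F] of edges is again bipartite, so the deletion lowers the chromatic
    index exactly when it lowers the maximum degree, that is, when every vertex
    of maximum degree is an end of some edge of [F]
    ([chromatic_index_delete_lt]).  The index sought is therefore the least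
    size of a set of edges covering the set [T] of vertices of maximum degree.
    The edges of such a set may have ends outside [T].

    That least size is given by Gallai's edge cover argument.  A maximum
    matching of the subgraph induced by [T], with one more edge for each vertex
    of [T] that it leaves uncovered, is a cover of the required size
    ([edge_cover_exists]).  Conversely, inside a cover [F], choose a largest
    matching with all ends in [T].  Two vertices of [T] outside this matching
    cannot share an edge of [F], which could be added to it; each of them thus
    costs an edge of its own ([edge_cover_ge]).

    König's theorem is proved by extremality and Kempe chains.  Take a proper
    partial coloring with [k] colors that colors as many edges as possible,
    [k] being at least every degree.  If the edge [uv] is uncolored, some color
    [a] is missing at [u] and some color [b] at [v].  Exchanging [a] and [b]
    along the chain that starts at [v] makes [a] missing at [v]; in a bipartite
    graph the chain does not reach [u], by parity, so [a] is still missing at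
    [u], and [uv] can receive the color [a], against maximality. *)

Set Implicit Arguments.
Unset Strict Implicit.
Unset Printing Implicit Defensive.

(** * Edges and degrees *)

Lemma set2_inj (T : finType) (x : T) : injective (fun y => [set x; y]).
Proof.
move=> y z /= /setP e.
have := e y; rewrite !inE eqxx orbT => /esym/orP[/eqP yx|/eqP//].
by have := e z; rewrite yx !inE eqxx orbT orbb => /eqP->.
Qed.

Lemma adj_edges (G : sgraph) (x y : G) : adj x y -> [set x; y] \in edges G.
Proof. by move=> xy; apply/edgesP; exists x, y. Qed.

Lemma edge_other_end (G : sgraph) (f : {set G}) (x : G) :
  f \in edges G -> x \in f -> exists2 y, adj x y & f = [set x; y].
Proof.
case/edgesP=> y [z [yz ->]]; rewrite !inE => /orP[]/eqP->; first by exists z.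
by exists y; rewrite 1?adj_sym // setUC.
Qed.

Lemma card_edge (G : sgraph) (f : {set G}) : f \in edges G -> #|f| = 2.
Proof.
case/edgesP=> x [y [xy ->]]; rewrite cards2.
by case: eqVneq xy => // ->; rewrite adj_irrefl.
Qed.

Lemma leq_degree_max (G : sgraph) (x : G) : degree x <= max_degree G.
Proof. exact: (@leq_bigmax _ (@degree G)). Qed.

Lemma max_degree_gt0 (G : sgraph) : edges G != set0 -> 0 < max_degree G.
Proof.
case/set0Pn=> f /edgesP[x [y [xy _]]]; apply: leq_trans (leq_degree_max x).
by rewrite card_gt0; apply/set0Pn; exists y; rewrite inE.
Qed.

Lemma incident_edge_exists (G : sgraph) (x : G) :
  0 < degree x -> exists2 f, f \in edges G & x \in f.
Proof.
rewrite card_gt0 => /set0Pn[y]; rewrite inE => xy.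
by exists [set x; y]; rewrite ?adj_edges // !inE eqxx.
Qed.

(** The edges at a vertex have pairwise distinct colors. *)
Lemma degree_le_edge_colorable (G : sgraph) k (x : G) :
  edge_colorable G k -> degree x <= k.
Proof.
case/existsP=> c /forallP cP.
pose E := [set f : edge G | x \in val f].
have degE : degree x <= #|E|.
  rewrite -(card_imset _ val_inj) /degree -(card_imset _ (@set2_inj G x)).
  apply/subset_leq_card/subsetP=> _ /imsetP[y + ->]; rewrite inE => xy.
  by apply/imsetP; exists (exist _ [set x; y] (adj_edges xy)); rewrite //= !inE eqxx.
apply: leq_trans degE _; rewrite -[k in _ <= k]card_ord -(@card_in_imset _ _ c E).
  exact: max_card.
move=> f g; rewrite !inE => xf xg cfg; apply/eqP; apply: contraT => fNg.
have := implyP (forallP (cP f) g); rewrite cfg eqxx; apply.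
by rewrite /incident fNg; apply/set0Pn; exists x; rewrite inE xf.
Qed.

Lemma edge_colorable_chromatic_index (G : sgraph) :
  edge_colorable G (chromatic_index G).
Proof. by rewrite /chromatic_index; case: ex_minnP. Qed.

Lemma chromatic_index_min (G : sgraph) k :
  edge_colorable G k -> chromatic_index G <= k.
Proof. by rewrite /chromatic_index; case: ex_minnP => m _; apply. Qed.

Lemma max_degree_le_chromatic_index (G : sgraph) :
  max_degree G <= chromatic_index G.
Proof.
apply/bigmax_leqP=> x _.
exact/degree_le_edge_colorable/edge_colorable_chromatic_index.
Qed.

(** * Edge colorings of bipartite graphs *)

(** The value [None] marks an uncolored edge, so that the empty coloring is
    available even for [k = 0].  Coloring sets of vertices makes the color of an
    edge independent of the order of its ends without a symmetry condition. *)
Definition proper_partial (G : sgraph) k (c : {ffun {set G} -> option 'I_k}) :=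
  [forall x : G, forall y : G, forall z : G, forall a : 'I_k,
    [&& adj x y, adj x z, c [set x; y] == Some a & c [set x; z] == Some a]
      ==> (y == z)].

Lemma proper_partialP (G : sgraph) k (c : {ffun {set G} -> option 'I_k}) :
  reflect (forall x y z a, adj x y -> adj x z ->
             c [set x; y] = Some a -> c [set x; z] = Some a -> y = z)
          (proper_partial c).
Proof.
apply: (iffP forallP) => [cP x y z a xy xz cy cz|cP x].
  apply/eqP; move/forallP: (cP x) => /(_ y)/forallP/(_ z)/forallP/(_ a).
  by rewrite xy xz cy cz !eqxx.
apply/forallP=> y; apply/forallP=> z; apply/forallP=> a.
by apply/implyP=> /and4P[xy xz /eqP cy /eqP cz]; rewrite (cP x y z a).
Qed.

Definition missing (G : sgraph) k (c : {ffun {set G} -> option 'I_k}) a x :=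
  forall y : G, adj x y -> c [set x; y] != Some a.

(** If every color occurred at [u], the neighbours of [u] would realize all
    [k] colors and also the value [None], at [v]: more than [k] values. *)
Lemma missing_color_exists (G : sgraph) k (c : {ffun {set G} -> option 'I_k})
    (u v : G) :
  degree u <= k -> adj u v -> c [set u; v] = None -> exists a, missing c a u.
Proof.
move=> du uv cuv.
case: (pickP (fun a => [forall y, adj u y ==> (c [set u; y] != Some a)])).
  by move=> a /forallP aP; exists a => y uy; apply: (implyP (aP y)).
move=> all_used; suff: k < degree u by rewrite ltnNge du.
rewrite -[k]card_ord -card_option -cardsT.
apply: leq_trans (leq_imset_card (fun y => c [set u; y]) _).
apply/subset_leq_card/subsetP=> -[a|] _; last first.
  by rewrite -cuv; apply: imset_f; rewrite inE.
have /negbT := all_used a; rewrite negb_forall => /existsP[y].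
rewrite negb_imply negbK => /andP[uy /eqP <-].
by apply: imset_f; rewrite inE.
Qed.

Lemma connect_last (T : finType) (r : rel T) (v x : T) :
  connect r v x -> x = v \/ exists2 z, connect r v z & r z x.
Proof.
case/connectP=> p; case/lastP: p => [|p z]; first by left.
rewrite rcons_path last_rcons => /andP[rp rz] ->; right.
by exists (last v p) => //; apply/connectP; exists p.
Qed.

(** The chain is followed from [v] along edges oriented away from [v]: color
    [a] when leaving the side of [v], color [b] when leaving the other side.
    The vertex [u] is on the other side, so it could be entered only by an edge
    of color [a], which is missing at [u]; this replaces the usual parity
    argument on paths.  The set [S] of vertices reached is closed under all
    edges of color [a] or [b], whatever their orientation, because a vertex of
    [S] other than [v] was entered by its only edge of the incoming color, and
    [v] has no such edge.  Hence exchanging [a] and [b] on the edges that meet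
    [S] keeps the coloring proper. *)
Lemma kempe_swap (G : sgraph) k (c : {ffun {set G} -> option 'I_k})
    (u v : G) (a b : 'I_k) :
  bipartite G -> proper_partial c -> adj u v ->
  missing c a u -> missing c b v ->
  exists c' : {ffun {set G} -> option 'I_k},
    [/\ proper_partial c', forall f, isSome (c' f) = isSome (c f),
        missing c' a u & missing c' a v].
Proof.
case=> A bipA /proper_partialP cP uv au bv.
pose same x := (x \in A) == (v \in A).
have sameN x y : adj x y -> same y = ~~ same x.
  by move=> /bipA; rewrite /same; do 3! case: (_ \in A).
pose r x y := adj x y && (c [set x; y] == Some (if same x then a else b)).
pose S := [set x | connect r v x].
have vS : v \in S by rewrite inE connect0.
have uS : u \notin S.
  rewrite inE; apply/negP=> /connect_last[uE|[z _ /andP[zu cz]]].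
    by rewrite uE adj_irrefl in uv.
  have uz : adj u z by rewrite adj_sym.
  have := au z uz; rewrite setUC (eqP cz).
  by rewrite (sameN _ _ uz) (sameN v) 1?adj_sym // /same !eqxx.
have closedS x y : x \in S -> adj x y ->
    c [set x; y] = Some a \/ c [set x; y] = Some b -> y \in S.
  move=> xS xy cxy.
  (* Forward edges stay in S by definition; backward ones lead to where x was
     entered from. *)
  have [cd|ce] : c [set x; y] = Some (if same x then a else b)
              \/ c [set x; y] = Some (if same x then b else a).
    by case: cxy => ->; case: (same x); [left|right|right|left].
    move: xS; rewrite !inE => xS; apply: connect_trans xS (connect1 _).
    by rewrite /r xy cd eqxx.
  move: (xS); rewrite inE => /connect_last[xE|[z zS /andP[zx /eqP cz]]].
    by have := bv y; rewrite -xE xy ce /same xE eqxx => /(_ isT); rewrite eqxx.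
  suff <- : z = y by rewrite inE.
  apply: (cP x _ _ _ _ xy _ ce); first by rewrite adj_sym.
  by rewrite setUC cz (sameN _ _ zx); case: (same z).
(* An edge meeting S only in its second end is not of color a or b, hence is
   unchanged: the exchange can be read off at either end. *)
pose c' := [ffun f => if f :&: S != set0 then omap (tperm a b) (c f) else c f].
have c'E x y : adj x y ->
    c' [set x; y] = if x \in S then omap (tperm a b) (c [set x; y])
                    else c [set x; y].
  move=> xy; rewrite ffunE; case: ifPn => [|/negPn/eqP/setP/(_ x)]; last first.
    by rewrite !inE eqxx /= => ->.
  case/set0Pn=> z; rewrite in_setI in_set2 => /andP[/orP[]/eqP-> zS].
    by rewrite zS.
  case: ifPn => // /negP xNS; case E: (c _) => [d|] //=; congr Some.
  have yx : adj y x by rewrite adj_sym.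
  by apply: tpermD; apply/eqP=> de; apply: xNS; apply: (closedS y x zS yx);
    rewrite setUC E -de; [left|right].
exists c'; split.
- apply/proper_partialP=> x y z d xy xz; rewrite !c'E //.
  case: ifP => _; last exact: cP.
  case Ey: (c _) => [dy|] //=; case Ez: (c _) => [dz|] //= [<-].
  by case=> /perm_inj dzy; apply: (cP x _ _ dy) => //; rewrite Ez dzy.
- by move=> f; rewrite ffunE; case: ifP => // _; case: (c f).
- by move=> y uy; rewrite c'E // (negPf uS); apply: au.
- move=> y vy; rewrite c'E // vS; case E: (c _) => [d|] //=.
  apply/eqP=> -[]; rewrite -{2}(tpermR a b) => /perm_inj db.
  by have := bv y vy; rewrite E db eqxx.
Qed.

Lemma proper_partial_augment (G : sgraph) k
    (c : {ffun {set G} -> option 'I_k}) (u v : G) (a : 'I_k) :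
  proper_partial c -> missing c a u -> missing c a v ->
  proper_partial [ffun f => if f == [set u; v] then Some a else c f].
Proof.
move=> /proper_partialP cP au av.
have abs x y d : adj x y -> x \in [set u; v] -> Some a = Some d ->
    c [set x; y] <> Some d.
  move=> xy + [<-]; rewrite !inE => /orP[]/eqP xE; rewrite xE in xy *.
    exact/eqP/au.
  exact/eqP/av.
apply/proper_partialP=> x y z d xy xz; rewrite !ffunE.
have [uvy|_] := eqVneq [set x; y] [set u; v];
  have [uvz|_] := eqVneq [set x; z] [set u; v]; last exact: cP.
- by move=> _ _; apply: (@set2_inj _ x); rewrite uvy uvz.
- by move=> da cz; case: (abs _ _ _ xz _ da cz); rewrite -uvy !inE eqxx.
- by move=> cy da; case: (abs _ _ _ xy _ da cy); rewrite -uvz !inE eqxx.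
Qed.

Lemma edge_colorable_total (G : sgraph) k
    (c : {ffun {set G} -> option 'I_k}) :
  proper_partial c -> (forall f, f \in edges G -> isSome (c f)) ->
  edge_colorable G k.
Proof.
move=> /proper_partialP cP ctot.
have [d dP] : exists d : edge G -> 'I_k, forall f, c (val f) = Some (d f).
  apply: (@fin_all_exists _ _ (fun f i => c (val f) = Some i)) => f.
  by case: (c _) (ctot _ (valP f)) => // i _; exists i.
apply/existsP; exists (finfun d); apply/forallP=> f; apply/forallP=> g.
apply/implyP=> /andP[+ /set0Pn[x]]; rewrite inE => + /andP[xf xg].
apply: contra; rewrite !ffunE => /eqP dfg; apply/eqP/val_inj.
have := dP g; have := dP f; rewrite dfg.
have [y xy ->] := edge_other_end (valP f) xf.
have [z xz ->] := edge_other_end (valP g) xg.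
by move=> cy cz; rewrite (cP x y z _ xy xz cy cz).
Qed.

Theorem konig_edge_coloring (G : sgraph) k :
  bipartite G -> (forall x : G, degree x <= k) -> edge_colorable G k.
Proof.
move=> bipG degk.
pose colored (c : {ffun {set G} -> option 'I_k}) := [set f in edges G | c f].
have P0 : proper_partial [ffun _ : {set G} => None : option 'I_k].
  by apply/proper_partialP=> x y z a _ _; rewrite ffunE.
case: (arg_maxnP (fun c => #|colored c|) P0) => c cP cmax.
apply: (edge_colorable_total cP) => f /edgesP[u [v [uv ->]]].
apply: contraT => uncol.
have cuv : c [set u; v] = None by case: (c _) uncol.
have [a au] := missing_color_exists (degk u) uv cuv.
have [b bv] : exists b, missing c b v.
  by apply: (missing_color_exists (v := u)); rewrite 1?adj_sym // setUC.
have [c' [c'P c'c au' av']] := kempe_swap bipG cP uv au bv.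
have /= := cmax _ (proper_partial_augment c'P au' av').
apply: contraTT => _; rewrite -ltnNge; apply/proper_card/properP; split.
  apply/subsetP=> g; rewrite !inE !ffunE => /andP[-> cg] /=.
  by case: ifP => // _; rewrite c'c.
by exists [set u; v]; rewrite inE ?ffunE ?eqxx adj_edges //= cuv.
Qed.

Lemma bipartite_delete (G : sgraph) (F : {set {set G}}) :
  bipartite G -> bipartite (delete_edges F).
Proof. by case=> A bipA; exists A => x y /andP[xy _]; apply: bipA. Qed.

Lemma chromatic_index_bipartite (G : sgraph) :
  bipartite G -> chromatic_index G = max_degree G.
Proof.
move=> bipG; apply/eqP; rewrite eqn_leq max_degree_le_chromatic_index andbT.
by apply/chromatic_index_min/konig_edge_coloring => // x; apply: leq_degree_max.
Qed.

(** * Stability index and deletions covering the maximum-degree vertices *)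

(** The index asks for a drop of exactly one.  Restoring one edge raises the
    chromatic index by at most one, so edges can be put back until the drop is
    exactly one. *)
Lemma edge_stability_index_le (G : sgraph) (F : {set {set G}}) :
  F \subset edges G -> chromatic_index (delete_edges F) < chromatic_index G ->
  edge_stability_index G <= #|F|.
Proof.
have [n] := ubnP #|F|; elim: n F => // n IHn F leFn FE Flt.
have [chiF|chiF] :=
    eqVneq (chromatic_index (delete_edges F)) (chromatic_index G).-1.
  rewrite /edge_stability_index; case: ex_minnP => m _; apply.
  by apply/existsP; exists F; rewrite FE chiF !eqxx.
have [F0|[f fF]] := set_0Vmem F.
  by move: Flt; rewrite F0 chromatic_index_delete0 ltnn.
have ltF : #|F :\ f| < #|F| by rewrite [#|F|](cardsD1 f) fF.
apply: leq_trans (ltnW ltF); apply: IHn.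
- exact: leq_trans ltF leFn.
- exact: subset_trans (subsetDl _ _) FE.
apply: leq_ltn_trans (chromatic_index_step F f) _.
by rewrite ltn_neqAle Flt andbT; apply: contra chiF => /eqP <-.
Qed.

Lemma degree_delete_le (G : sgraph) (F : {set {set G}}) (x : G) :
  @degree (delete_edges F) x <= degree x.
Proof.
by apply/subset_leq_card/subsetP=> y; rewrite !inE => /andP[].
Qed.

Lemma degree_delete_lt (G : sgraph) (F : {set {set G}}) (x : G) :
  F \subset edges G -> x \in cover F ->
  @degree (delete_edges F) x < degree x.
Proof.
move=> /subsetP FE /bigcupP[f fF xf].
have [y xy fE] := edge_other_end (FE _ fF) xf.
apply/proper_card/properP; split.
  by apply/subsetP=> z; rewrite !inE => /andP[].
by exists y; rewrite inE //= /delete_adj -fE fF andbF.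
Qed.

Lemma degree_delete_notin_cover (G : sgraph) (F : {set {set G}}) (x : G) :
  x \notin cover F -> @degree (delete_edges F) x = degree x.
Proof.
move=> xF; apply: eq_card => y; rewrite !inE /= /delete_adj.
case: (adj x y) => //=; apply: contraNN xF => xyF.
by apply/bigcupP; exists [set x; y]; rewrite // !inE eqxx.
Qed.

(** By König's theorem both chromatic indices are maximum degrees. *)
Lemma chromatic_index_delete_lt (G : sgraph) (F : {set {set G}}) :
  edges G != set0 -> bipartite G -> F \subset edges G ->
  (chromatic_index (delete_edges F) < chromatic_index G)
    = (max_degree_vertices G \subset cover F).
Proof.
move=> EG bipG FE; rewrite !chromatic_index_bipartite //; last first.
  exact: bipartite_delete.
apply/idP/subsetP=> [lt x|TF].
  rewrite inE => /eqP dx; apply: contraLR lt => /degree_delete_notin_cover.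
  by rewrite dx -leqNgt => <-; apply: (@leq_degree_max (delete_edges F)).
rewrite -[X in _ < X](prednK (max_degree_gt0 EG)) ltnS.
apply/bigmax_leqP=> x _; rewrite -ltnS (prednK (max_degree_gt0 EG)).
have [xT|xT] := boolP (x \in max_degree_vertices G).
  exact: leq_trans (degree_delete_lt FE (TF x xT)) (@leq_degree_max G x).
apply: leq_ltn_trans (degree_delete_le F x) _.
by rewrite ltn_neqAle (@leq_degree_max G) andbT; rewrite inE in xT.
Qed.

(** * Matchings and edge covers of a vertex set *)

Lemma card_cover_matching (G : sgraph) (M : {set {set G}}) :
  matching M -> #|cover M| = #|M|.*2.
Proof.
case/andP=> /subsetP ME /eqP <-.
by rewrite (eq_bigr (fun=> 2)) ?sum_nat_const ?muln2 // => f /ME/card_edge.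
Qed.

(** The edges of an induced subgraph are sets of elements of a subtype; this
    is the corresponding set of vertices of the ambient graph. *)
Definition embed (T : finType) (A : {set T}) (f : {set {x : T | x \in A}}) :
  {set T} := val @: f.

Lemma embed_inj (T : finType) (A : {set T}) : injective (@embed T A).
Proof. exact/imset_inj/val_inj. Qed.

Lemma embed2 (T : finType) (A : {set T}) (x y : {x : T | x \in A}) :
  embed [set x; y] = [set val x; val y].
Proof. by rewrite /embed imsetU1 imset_set1. Qed.

Lemma embed_disjoint (T : finType) (A : {set T})
    (f g : {set {x : T | x \in A}}) :
  [disjoint embed f & embed g] = [disjoint f & g].
Proof. exact/imset_disjoint/val_inj. Qed.

Lemma trivIset_embed (T : finType) (A : {set T})
    (M : {set {set {x : T | x \in A}}}) :
  trivIset (@embed T A @: M) = trivIset M.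
Proof.
apply/trivIsetP/trivIsetP => [tM f g fM gM fNg|tM f' g' /imsetP[f fM ->]].
  have := tM _ _ (imset_f _ fM) (imset_f _ gM).
  by rewrite (inj_eq (@embed_inj _ _)) embed_disjoint; apply.
move=> /imsetP[g gM ->]; rewrite (inj_eq (@embed_inj _ _)) embed_disjoint; exact: tM.
Qed.

Lemma edges_induced (G : sgraph) (A : {set G}) (f : {set induced A}) :
  (embed f \in edges G) = (f \in edges (induced A)).
Proof.
apply/idP/edgesP => [|[x [y [xy ->]]]]; last first.
  by rewrite embed2; apply: adj_edges.
case/edgesP=> x [y [xy fE]].
have /imsetP[x' _ xE] : x \in embed f by rewrite fE !inE eqxx.
have /imsetP[y' _ yE] : y \in embed f by rewrite fE !inE eqxx orbT.
exists x', y'; split; first by rewrite xE yE in xy.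
by apply: embed_inj; rewrite fE embed2 xE yE.
Qed.

Lemma matching_number_induced_ge (G : sgraph) (A : {set G})
    (M : {set {set G}}) :
  matching M -> cover M \subset A -> #|M| <= matching_number (induced A).
Proof.
move=> /andP[/subsetP ME tM] /subsetP MA.
pose N : {set {set induced A}} := [set f | embed f \in M].
have NM : @embed G A @: N = M.
  apply/setP=> f; apply/imsetP/idP => [[g + ->]|fM]; first by rewrite inE.
  have fE : f = embed [set x : induced A | val x \in f].
    apply/setP=> x; apply/idP/imsetP => [xf|[y + ->]]; last by rewrite inE.
    have xA : x \in A by apply/MA/bigcupP; exists f.
    by exists (Sub x xA); rewrite ?inE.
  by exists [set x : induced A | val x \in f]; rewrite // inE -fE.
rewrite -NM card_imset; last exact: embed_inj.
apply: (@leq_bigmax_cond _ _ (fun N : {set {set induced A}} => #|N|)).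
rewrite /matching -trivIset_embed NM tM andbT.
by apply/subsetP=> f; rewrite inE -edges_induced => /ME.
Qed.

Lemma matching_number_induced_witness (G : sgraph) (A : {set G}) :
  exists M : {set {set G}},
    [/\ matching M, cover M \subset A & #|M| = matching_number (induced A)].
Proof.
have M0 : matching (set0 : {set {set induced A}}).
  by rewrite /matching sub0set; apply/trivIsetP=> f g; rewrite inE.
rewrite /matching_number (bigop.bigmax_eq_arg _ M0).
case: arg_maxnP => //= N /andP[/subsetP NE tN] _.
exists (@embed G A @: N); split.
- rewrite /matching trivIset_embed tN andbT.
  by apply/subsetP=> _ /imsetP[f /NE fE ->]; rewrite edges_induced.
- apply/subsetP=> x /bigcupP[_ /imsetP[f _ ->] /imsetP[y _ ->]].
  exact: valP.
- by rewrite card_imset //; apply: embed_inj.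
Qed.

(** Let [M] be a largest matching contained in [F] with all ends in [T].  It
    covers [2 * #|M|] vertices of [T]; sending every other vertex of [T] to an
    edge of [F] containing it is injective and avoids [M].  Hence
    [#|T| <= 2 * #|M| + (#|F| - #|M|) = #|F| + #|M|]. *)
Lemma edge_cover_ge (G : sgraph) (T : {set G}) (F : {set {set G}}) :
  F \subset edges G -> T \subset cover F ->
  #|T| - matching_number (induced T) <= #|F|.
Proof.
move=> /subsetP FE /subsetP TF.
pose P (M : {set {set G}}) := [&& M \subset F, trivIset M & cover M \subset T].
have P0 : P set0.
  rewrite /P !sub0set /cover big_set0 sub0set andbT.
  by apply/trivIsetP=> f g; rewrite inE.
case: (arg_maxnP (fun M : {set {set G}} => #|M|) P0) => M /and3P[MF tM MT] Mmax.
have matM : matching M.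
  by rewrite /matching tM andbT; apply/subsetP=> f /(subsetP MF)/FE.
(* The implication under the existential gives a choice function on all of G;
   outside T its value is arbitrary. *)
have incF (x : G) : exists f, x \in T -> f \in F /\ x \in f.
  have [/TF/bigcupP[f fF xf]|_] := boolP (x \in T); last by exists set0.
  by exists f.
have {incF}[e eP] := fin_all_exists incF.
have eD x : x \in T :\: cover M -> e x \in F :\: M.
  rewrite !inE => /andP[xM /eP[-> xe]]; rewrite andbT.
  by apply: contra xM => eM; apply/bigcupP; exists (e x).
have e_inj : {in T :\: cover M &, injective e}.
  move=> x y xD yD exy; apply/eqP; apply: contraT => xNy.
  have [/eP[eF xe] xM] := setDP xD; have [/eP[_ ye] yM] := setDP yD.
  have [z xz eE] := edge_other_end (FE _ eF) xe.
  have yz : y = z.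
    by move: ye; rewrite -exy eE !inE eq_sym (negPf xNy) => /eqP.
  (* A common edge would have both ends in T and off M, so it would extend M. *)
  have := Mmax (e x |: M); rewrite cardsU1.
  have [_ -> /=] := setDP (eD x xD); rewrite ltnn; apply.
  have dis : {in M, forall f : {set G}, [disjoint e x & f]}.
    move=> f fM; rewrite -setI_eq0 eE -yz -subset0; apply/subsetP=> w.
    rewrite !inE => /andP[/orP[]/eqP-> wf]; [case/negP: xM|case/negP: yM];
    by apply/bigcupP; exists f.
  have M0 : set0 \notin M.
    by apply/negP=> /(subsetP MF)/FE/card_edge; rewrite cards0.
  apply/and3P; split; first by rewrite subUset sub1set eF.
    by have [] := trivIsetU1 dis tM M0.
  rewrite /cover bigcup_setU big_set1 subUset MT andbT eE -yz.
  by apply/subsetP=> w; rewrite !inE => /orP[]/eqP->;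
    have [] := setDP xD; have [] := setDP yD.
have leD : #|T :\: cover M| <= #|F :\: M|.
  rewrite -(card_in_imset e_inj); apply/subset_leq_card/subsetP.
  by move=> _ /imsetP[x xD ->]; apply: eD.
rewrite leq_subLR.
apply: leq_trans (leq_add (matching_number_induced_ge matM MT) (leqnn _)).
rewrite -(cardsID (cover M) T) (setIidPr MT) card_cover_matching //.
rewrite -(cardsID M F) (setIidPr MF) -addnn -!addnA.
by rewrite !leq_add2l.
Qed.

(** A maximum matching [M] of the subgraph induced by [T] leaves
    [#|T| - 2 * #|M|] vertices of [T] uncovered; with one further edge for each,
    [#|T| - #|M|] edges suffice. *)
Lemma edge_cover_exists (G : sgraph) (T : {set G}) :
  (forall x, x \in T -> 0 < degree x) ->
  exists F : {set {set G}},
    [/\ F \subset edges G, T \subset cover F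
      & #|F| <= #|T| - matching_number (induced T)].
Proof.
move=> degT; have [M [matM MT cardM]] := matching_number_induced_witness T.
have inc (x : G) : exists f, x \in T -> f \in edges G /\ x \in f.
  have [/degT/incident_edge_exists[f fE xf]|_] := boolP (x \in T).
    by exists f.
  by exists set0.
have {inc}[e eP] := fin_all_exists inc.
exists (M :|: e @: (T :\: cover M)); split.
- have /andP[ME _] := matM; rewrite subUset ME /=.
  by apply/subsetP=> _ /imsetP[x /setDP[/eP[eE _] _] ->].
- apply/subsetP=> x xT; rewrite /cover bigcup_setU inE -/(cover M).
  case: (boolP (x \in cover M)) => //= xM.
  apply/bigcupP; exists (e x); last by case: (eP x xT).
  by apply: imset_f; rewrite inE xM.
rewrite -cardM; apply: leq_trans (leq_card_setU _ _).1 _.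
apply: leq_trans (leq_add (leqnn _) (leq_imset_card _ _)) _.
rewrite cardsD (setIidPr MT) card_cover_matching // -addnn.
have : #|M| + #|M| <= #|T|.
  by rewrite addnn -card_cover_matching // subset_leq_card.
move=> leMT; rewrite subnDA addnC subnK // leq_subRL //.
exact: leq_trans (leq_addl _ _) leMT.
Qed.

(** * The chromatic edge stability index *)

Theorem theorem6 (G : sgraph) (hE : edges G != set0) (hG : bipartite G) :
  edge_stability_index G =
    #|max_degree_vertices G|
      - matching_number (induced (max_degree_vertices G)).
Proof.
apply/eqP; rewrite eqn_leq; apply/andP; split.
  have [x|F [FE TF leF]] := @edge_cover_exists G (max_degree_vertices G).
    by rewrite inE => /eqP->; apply: max_degree_gt0.
  apply: leq_trans leF; apply: edge_stability_index_le => //.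
  by rewrite chromatic_index_delete_lt.
rewrite /edge_stability_index.
case: ex_minnP => m /existsP[F /and3P[FE /eqP <- /eqP chiF]] _.
apply: edge_cover_ge => //; rewrite -chromatic_index_delete_lt // chiF prednK //.
by apply: leq_trans (max_degree_gt0 hE) (max_degree_le_chromatic_index G).
Qed.
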